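(* Let $M$ be a smooth manifold, $\tau\in\Omega^1(M)$, $\omega\in\Omega^2(M)$, and $r\ge 0$ an integer. The pair $(\tau,\omega)$ is a doublet of class $2r$ if, and only if, at every point of $M$, $$\omega^r\neq 0,\qquad \omega^{r+1}=0,\qquad \tau\wedge\omega^r=0.$$ If, additionally, $\tau$ is nowhere-vanishing, then $(\tau,\omega)$ is a doublet of class $2r$ if, and only if, at every point of $M$, $$\omega^r\neq 0,\qquad \tau\wedge\omega^r=0.$$
   Context: The class of a pair $(\tau,\omega)$ at $x\in M$ is the codimension in $T_xM$ of $\operatorname{Ker}\tau_x\cap\operatorname{Ker}\omega_x$, where $\operatorname{Ker}\alpha_x=\{v\in T_xM\mid\iota_v\alpha_x=0\}$. The pair is called a doublet if its class is constant on $M$. $\omega^r$ denotes the exterior product of $r$ copies of $\omega$ (with $\omega^0=1$). *)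

(* Defs.v *)
From HB Require Import structures.
From mathcomp Require Import all_boot all_order all_algebra all_fingroup.
From mathcomp Require Import all_classical all_reals all_analysis.

Set Implicit Arguments.
Unset Strict Implicit.
Unset Printing Implicit Defensive.

Import Order.TTheory GRing.Theory Num.Theory numFieldNormedType.Exports.

Local Open Scope classical_set_scope.
Local Open Scope ring_scope.

Section ExteriorForms.
Context {R : realType} {V : lmodType R}.

Definition subst_slot k (v : 'I_k -> V) (i : 'I_k) (u : V) : 'I_k -> V :=
  fun j => if j == i then u else v j.

Definition is_multilinear k (a : ('I_k -> V) -> R) : Prop :=
  forall (v : 'I_k -> V) (i : 'I_k) (t : R) (u w : V),
    a (subst_slot v i (t *: u + w))
    = t * a (subst_slot v i u) + a (subst_slot v i w).

Definition is_alternating k (a : ('I_k -> V) -> R) : Prop :=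
  forall (v : 'I_k -> V) (i j : 'I_k), i != j -> v i = v j -> a v = 0.

Definition vcons k (u : V) (v : 'I_k -> V) : 'I_k.+1 -> V :=
  fun i => if unlift ord0 i is Some j then v j else u.

Definition contraction k (u : V) (a : ('I_k.+1 -> V) -> R) : ('I_k -> V) -> R :=
  fun v => a (vcons u v).

Definition Ker k (a : ('I_k.+1 -> V) -> R) : set V :=
  [set u | contraction u a = 0].

Lemma Ker_linear k (a : ('I_k.+1 -> V) -> R) : is_multilinear a ->
  Ker a 0 /\
  forall (t : R) u w, Ker a u -> Ker a w -> Ker a (t *: u + w).
Proof.
move=> lin_a.
have vconsE (u : V) (v : 'I_k -> V) : vcons u v = subst_slot (vcons 0 v) ord0 u.
  apply/funext => i; rewrite /vcons /subst_slot.
  by case: (unliftP ord0 i) => [j ->|->] //; rewrite eqxx.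
have lin t u w v : contraction (t *: u + w) a v
    = t * contraction u a v + contraction w a v.
  by rewrite /contraction (vconsE (_ + _)) (vconsE u) (vconsE w) lin_a.
split=> [|t u w Hu Hw]; apply/funext => v.
  by have := lin (-1) 0 0 v; rewrite scaler0 addr0 mulN1r addNr.
have lu : contraction u a v = 0 by rewrite Hu.
have lw : contraction w a v = 0 by rewrite Hw.
by rewrite lin lu lw mulr0 addr0.
Qed.

(* [lshift]/[rshift] split the [k + l] permuted arguments into the first [k]
   and the last [l]; the normalisation is the determinant convention, so that
   for 1-forms (a /\ b)(u, v) = a u * b v - a v * b u. *)
Definition wedge k l (a : ('I_k -> V) -> R) (b : ('I_l -> V) -> R) :
    ('I_(k + l) -> V) -> R :=
  fun v => (k`!%:R * l`!%:R)^-1 *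
    \sum_(s : 'S_(k + l)) (-1) ^+ s *
       (a (fun i => v (s (lshift l i))) * b (fun j => v (s (rshift k j)))).

Fixpoint wedge_pow (w : ('I_2 -> V) -> R) (r : nat) : ('I_(r * 2) -> V) -> R :=
  match r return ('I_(r * 2) -> V) -> R with
  | 0%N => fun _ => 1
  | r'.+1 => wedge w (@wedge_pow w r')
  end.

End ExteriorForms.
Arguments wedge_pow {R V} w r _ : rename.

Section Codimension.
Context {R : realType} {V : vectType R}.

Lemma linear_set_vspace (K : set V) :
  K 0 -> (forall (t : R) u w, K u -> K w -> K (t *: u + w)) ->
  exists U : {vspace V}, [set` U] = K.
Proof.
move=> K0 Klin.
pose P d := `[< exists2 U : {vspace V}, [set` U] `<=` K & \dim U = d >].
have exP : exists d, P d.
  exists 0%N; apply/asboolP; exists 0%VS; last exact: dimv0.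
  by move=> u /=; rewrite memv0 => /eqP->.
have ubP d : P d -> (d <= \dim {:V})%N.
  by move=> /asboolP[U _ <-]; apply/dimvS/subvf.
case: (ex_maxnP exP ubP) => d /asboolP[U UK dimU] maxd.
exists U; apply/seteqP; split => // u Ku /=.
have addK u' w' : K u' -> K w' -> K (u' + w').
  by move=> Ku' Kw'; rewrite -[u']scale1r; exact: Klin.
have UuK : [set` (U + <[u]>)%VS] `<=` K.
  move=> _ /memv_addP[w Uw [z /vlineP[t ->] ->]].
  apply: addK; first exact: UK.
  by rewrite -[t *: u]addr0; exact: Klin.
have : P (\dim (U + <[u]>)) by apply/asboolP; exists (U + <[u]>)%VS.
move=> /maxd; rewrite -dimU => le_dim.
have /eqP-> : (U == U + <[u]>)%VS by rewrite eqEdim addvSl.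
by rewrite memvE addvSr.
Qed.

(* Meaningful for linear subspaces [K] only; see [codimE] and
   [pair_kernel_vspace]. *)
Definition codim (K : set V) : nat :=
  (\dim {:V} - \dim (xget 0%VS [set U : {vspace V} | [set` U] = K]))%N.

Lemma codimE (U : {vspace V}) : codim [set` U] = (\dim {:V} - \dim U)%N.
Proof.
rewrite /codim; case: xgetP => [W _ /= eqWU | /(_ U)]; last by case.
congr (_ - \dim _)%N; apply/vspaceP => u.
by have := congr1 (fun A : set V => A u) eqWU => /= /is_true_inj.
Qed.

End Codimension.

Lemma diff_comp_derive (R : numFieldType) (U V W : normedModType R)
    (f : U -> V) (g : V -> W) (x : U) (y : V) (u : U) : f x = y ->
  differentiable f x -> differentiable g y ->
  'd g y ('d f x u) = 'D_u (g \o f) x.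
Proof.
move=> <- df dg; rewrite deriveE; last exact: differentiable_comp.
by rewrite (diff_comp df dg).
Qed.

Section SmoothMaps.
Context {R : realType} {V W : normedModType R}.

Fixpoint Ck_on (k : nat) (D : set V) (f : V -> W) : Prop :=
  match k with
  | 0%N => forall x, D x -> {for x, continuous f}
  | k'.+1 => (forall x, D x -> differentiable f x) /\
             (forall v, Ck_on k' D (fun x => 'd f x v))
  end.

(* Intended for open [D]. *)
Definition smooth_on (D : set V) (f : V -> W) : Prop :=
  forall k, Ck_on k D f.

End SmoothMaps.

(* [chart_inv] is only relevant on the image of [chart_dom]. *)
Record chart (R : realType) (n : nat) (T : topologicalType) := Chart {
  chart_dom : set T;
  chart_fun :> T -> 'rV[R]_n;
  chart_inv : 'rV[R]_n -> T;
  chart_dom_open : open chart_dom;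
  chart_cod_open : open (chart_fun @` chart_dom);
  chart_continuous : {within chart_dom, continuous chart_fun};
  chart_inv_continuous :
    {within chart_fun @` chart_dom, continuous chart_inv};
  chartK : forall x, chart_dom x -> chart_inv (chart_fun x) = x
}.

Definition transition (R : realType) (n : nat) (T : topologicalType)
    (c d : chart R n T) : 'rV[R]_n -> 'rV[R]_n :=
  fun y => d (chart_inv c y).

Definition transition_diff (R : realType) (n : nat) (T : topologicalType)
    (c d : chart R n T) (x : T) : 'rV[R]_n -> 'rV[R]_n :=
  fun u => 'd (transition c d) (c x) u.

Lemma transition_diff_linear (R : realType) (n : nat) (T : topologicalType)
    (c d : chart R n T) (x : T) : linear (transition_diff c d x).
Proof. by move=> t u w; rewrite /transition_diff linearP. Qed.

Record manifold (R : realType) (n : nat) := Manifold {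
  manifold_sort :> topologicalType;
  manifold_hausdorff : hausdorff_space manifold_sort;
  manifold_second_countable : @second_countable manifold_sort;
  atlas : set (chart R n manifold_sort);
  atlas_cover : forall x, exists2 c, atlas c & chart_dom c x;
  atlas_smooth : forall c d, atlas c -> atlas d ->
    smooth_on (c @` (chart_dom c `&` chart_dom d)) (transition c d)
}.

Arguments atlas {R n} M _ : rename.

Section Tangent.
Context {R : realType} {n : nat} {M : manifold R n}.
Implicit Types x : M.

Definition charts_at x : Type :=
  {c : chart R n M | atlas M c /\ chart_dom c x}.

(* A tangent vector at [x] is a family of coordinate vectors, one for each chart
   of the atlas at [x], related by the Jacobians of the transition maps. *)
Definition tangent_coherent x (v : charts_at x -> 'rV[R]_n) : Prop :=
  forall c d : charts_at x,
    v d = transition_diff (sval c) (sval d) x (v c).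

Definition tangent_pred x : {pred charts_at x -> 'rV[R]_n} :=
  fun v => `[< tangent_coherent v >].

Record tangent x := Tangent {
  tangent_coord : charts_at x -> 'rV[R]_n;
  _ : tangent_coord \in @tangent_pred x
}.

End Tangent.
Arguments tangent {R n M} x.
Arguments tangent_pred {R n M} x _ /.

Section TangentVect.
Context {R : realType} {n : nat} {M : manifold R n}.
Variable x : M.

HB.instance Definition _ := [isSub for @tangent_coord R n M x].
HB.instance Definition _ := [Choice of tangent x by <:].

Lemma tangent_submod : submod_closed (tangent_pred x).
Proof.
split; first by apply/asboolP => c d; rewrite /transition_diff linear0.
move=> t u w /asboolP Hu /asboolP Hw; apply/asboolP => c d.
by rewrite transition_diff_linear -(Hu c d) -(Hw c d).
Qed.

HB.instance Definition _ :=
  GRing.isSubmodClosed.Build R _ (tangent_pred x) tangent_submod.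
HB.instance Definition _ := [SubChoice_isSubZmodule of tangent x by <:].
HB.instance Definition _ := [SubZmodule_isSubLmodule of tangent x by <:].

Lemma transition_differentiable (c d : charts_at x) :
  differentiable (transition (sval c) (sval d)) (sval c x).
Proof.
case: c d => c [cA cx] [d [dA dx]] /=.
have [+ _] := atlas_smooth cA dA 1; apply.
by exists x.
Qed.

Lemma transition_id (c : charts_at x) u :
  transition_diff (sval c) (sval c) x u = u.
Proof.
rewrite /transition_diff -deriveE; last exact: transition_differentiable.
case: c => c [cA cx] /=.
rewrite (@near_eq_derive _ _ _ _ id); first by rewrite derive_id.
have : nbhs (c x) (c @` chart_dom c).
  by apply: open_nbhs_nbhs; split; [exact: chart_cod_open | exists x].
apply: filterS => _ [y cy <-].
by rewrite /transition chartK.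
Qed.

Lemma transition_chain (c d e : charts_at x) u :
  transition_diff (sval d) (sval e) x (transition_diff (sval c) (sval d) x u)
  = transition_diff (sval c) (sval e) x u.
Proof.
have dcd := transition_differentiable c d.
have dde := transition_differentiable d e.
have dce := transition_differentiable c e.
move: c d e dcd dde dce => [c [cA cx]] [d [dA dx]] [e [eA ex]] /= dcd dde dce.
have cdx : transition c d (c x) = d x by rewrite /transition chartK.
apply: etrans (diff_comp_derive u cdx dcd dde) _.
apply: etrans (deriveE u dce).
apply: near_eq_derive.
have oc : open (c @` chart_dom c) := chart_cod_open (c := c).
have nc : nbhs (c x) (c @` chart_dom c).
  by apply: open_nbhs_nbhs; split => //; exists x.
have : nbhs (c x) (chart_inv c @^-1` chart_dom d).
  have := chart_inv_continuous (c := c); rewrite continuous_open_subspace //.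
  move=> /(_ (c x)) h; apply: h; first by rewrite inE; exists x.
  rewrite chartK //; apply: open_nbhs_nbhs; split => //.
  exact: chart_dom_open.
apply: filterS2 nc => _ [y cy <-]; rewrite /= chartK // => dy.
by rewrite /transition !chartK.
Qed.

Lemma tangent_of_subproof (c : charts_at x) (u : 'rV[R]_n) :
  (fun d : charts_at x => transition_diff (sval c) (sval d) x u)
    \in tangent_pred x.
Proof. by apply/asboolP => d e; rewrite transition_chain. Qed.

(* The tangent vector at [x] with coordinate vector [u] in the chart [c]. *)
Definition tangent_of (c : charts_at x) (u : 'rV[R]_n) : tangent x :=
  Tangent (tangent_of_subproof c u).

Lemma tangent_vect_axiom : Vector.axiom n (tangent x).
Proof.
have [c cA cx] := cid2 (atlas_cover x).
pose c0 : charts_at x := exist _ c (conj cA cx).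
exists (fun v => tangent_coord v c0) => //.
exists (tangent_of c0) => [v|u]; last exact: (transition_id c0 u).
apply: val_inj; apply/funext => d.
by case: v => v Hv; move/asboolP: (Hv) => /(_ c0 d).
Qed.

HB.instance Definition _ := Lmodule_hasFinDim.Build R (tangent x)
  tangent_vect_axiom.

End TangentVect.

Section DifferentialForms.
Context {R : realType} {n : nat} {M : manifold R n}.

Definition coord_vector (c : chart R n M) (x : M) (i : 'I_n) : tangent x :=
  match pselect (atlas M c /\ chart_dom c x) with
  | left cx => tangent_of (exist _ c cx) (delta_mx 0 i)
  | right _ => 0
  end.

Definition smooth_form k (a : forall x : M, ('I_k -> tangent x) -> R) : Prop :=
  forall c, atlas M c -> forall s : 'I_k -> 'I_n,
    smooth_on (c @` chart_dom c)
      (fun y => a (chart_inv c y)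
                  (fun j => coord_vector c (chart_inv c y) (s j))).

End DifferentialForms.

Record diff_form (R : realType) (n : nat) (M : manifold R n) (k : nat) :=
  DiffForm {
    form_at :> forall x : M, ('I_k -> tangent x) -> R;
    form_multilinear : forall x, is_multilinear (@form_at x);
    form_alternating : forall x, is_alternating (@form_at x);
    form_smooth : smooth_form (@form_at)
  }.
Arguments form_at {R n M k} _ x _ : rename.
Arguments form_multilinear {R n M k} a x : rename.
Arguments form_alternating {R n M k} a x : rename.

Section Doublets.
Context {R : realType} {n : nat} {M : manifold R n}.

Definition pair_class (tau : diff_form M 1) (omega : diff_form M 2) (x : M) :
    nat :=
  codim (Ker (tau x) `&` Ker (omega x)).

Lemma pair_kernel_vspace (tau : diff_form M 1) (omega : diff_form M 2)
    (x : M) :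
  exists U : {vspace tangent x}, [set` U] = Ker (tau x) `&` Ker (omega x).
Proof.
have [t0 tl] := Ker_linear (form_multilinear tau x).
have [w0 wl] := Ker_linear (form_multilinear omega x).
apply: linear_set_vspace => // t u v [tu wu] [tv wv].
by split; [exact: tl | exact: wl].
Qed.

Definition doublet (tau : diff_form M 1) (omega : diff_form M 2) : Prop :=
  exists m, forall x, pair_class tau omega x = m.

Definition doublet_of_class (tau : diff_form M 1) (omega : diff_form M 2)
    (m : nat) : Prop :=
  doublet tau omega /\ forall x, pair_class tau omega x = m.

End Doublets.

(* Main.v *)
Require Import Defs.
From mathcomp Require Import all_boot all_order all_algebra all_fingroup.
From mathcomp Require Import all_classical all_reals all_analysis.
From mathcomp Require Import ring lra zify.

(** Everything happens in one tangent space [V], of dimension [D]; write [w] for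
    the value of [omega], [N] for its kernel and [K] for the intersection of
    [N] with the kernel of [tau]. Adding one linear condition to [N] costs at
    most one dimension: [\dim K <= \dim N <= \dim K + 1].

    Three facts determine which powers vanish.

    - An alternating form of degree [m] that vanishes as soon as one argument
      lies in a subspace [S] is zero when [m > D - \dim S], because [m] vectors
      are then dependent modulo [S] ([form_eq0]). So [w^r = 0] when
      [2r > D - \dim N], and [tau /\ w^r = 0] when [2r + 1 > D - \dim K].

    - Conversely [w^r <> 0] as soon as [2r <= D - \dim N + 1]
      ([wedge_pow_neq0]). Choose [e], [f] with [w (e, f) <> 0] and pass to their
      [w]-orthogonal: the dimension drops by at most two and the radical does
      not grow, so this can be repeated [r] times. On the hyperbolic pairs so
      obtained, [w^(r+1) (e, f, v) = (r + 1) w (e, f) w^r (v)]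
      ([wedge_pow_pair]). The slack of one is the parity of the rank of [w].

    - If [u] is [w]-orthogonal to all entries of [v], then
      [(tau /\ w^r) (u, v) = tau u * w^r (v)] ([wedge1_orth]). With [u] in [N]
      this shows that [tau /\ w^r = 0 <> w^r] forces [tau] to vanish on [N],
      that is [K = N].

    If [D - \dim K = 2r], the first two facts give the three conditions.
    If the conditions hold, the third fact gives [K = N], and the first two
    squeeze [D - \dim N] between [2r] and [2r].

    When [tau <> 0], the condition [w^(r+1) = 0] follows from the other two.
    Otherwise [D - \dim N >= 2r + 2]; take [u] with [tau u <> 0], outside [N] by
    the third fact, and [f] with [w (u, f) <> 0]. The orthogonal of [u] and [f]
    still contains [r] hyperbolic pairs, hence [v] with [w^r (v) <> 0], and
    [(tau /\ w^r) (u, v) = tau u * w^r (v)] is not zero. *)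

Import Order.TTheory GRing.Theory Num.Theory.
Local Open Scope ring_scope.

(** * Expansion of wedge products along their first arguments *)

Section LiftSum.
Local Set Implicit Arguments.
Local Unset Strict Implicit.

(** A permutation of [n + 1] points is its first value [j] together with a
    permutation of [n] points; [lift_perm] is this bijection, and it shifts the
    sign by [(-1) ^ j]. *)
Lemma sum_perm_lift (R : pzRingType) n
    (G : 'I_n.+1 -> ('I_n -> 'I_n.+1) -> R) :
  \sum_(s : 'S_n.+1) (-1) ^+ s * G (s ord0) (fun i => s (lift ord0 i)) =
  \sum_(j < n.+1) \sum_(t : 'S_n)
     (-1) ^+ j * ((-1) ^+ t * G j (fun i => lift j (t i))).
Proof.
rewrite pair_big /=.
pose h (jt : 'I_n.+1 * 'S_n) := lift_perm ord0 jt.1 jt.2.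
have hinj : injective h.
  move=> [j t] [j' t'] /permP E.
  have Ej : j = j' by have := E ord0; rewrite /h !lift_perm_id.
  rewrite -{}Ej in E *; congr (_, _); apply/permP => i.
  by have := E (lift ord0 i); rewrite /h !lift_perm_lift => /lift_inj.
have hbij : bijective h.
  by apply: inj_card_bij hinj _; rewrite card_prod !card_Sn card_ord factS.
rewrite (reindex h) /=; last exact: onW_bij.
apply: eq_bigr => -[j t] _; rewrite /h /= odd_lift_perm lift_perm_id /=.
rewrite signr_addb signr_odd mulrA; congr (_ * G j _).
by apply/funext => i; rewrite lift_perm_lift.
Qed.

End LiftSum.

Section Wedge.
Local Set Implicit Arguments.
Local Unset Strict Implicit.
Context {R : realType} {V : lmodType R}.

(** Stated for permuted rather than for repeated arguments, because this is what
    collapses the inner sums over permutations in the expansions below. *)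
Definition antisymmetric_form k (a : ('I_k -> V) -> R) : Prop :=
  forall (s : 'S_k) v, a (fun i => v (s i)) = (-1) ^+ s * a v.

Definition vpair (u w : V) : 'I_2 -> V := fun i => if i == ord0 then u else w.

Lemma wedge_antisymmetric k l (a : ('I_k -> V) -> R) (b : ('I_l -> V) -> R) :
  antisymmetric_form (wedge a b).
Proof.
move=> t v; rewrite /wedge mulrCA; congr (_ * _).
rewrite [in RHS](reindex_inj (mulIg t)) /= mulr_sumr; apply: eq_bigr => s _.
rewrite odd_permM addbC signr_addb -mulrA signrMK.
by congr (_ * (a _ * b _)); apply/funext => i; rewrite permM.
Qed.

Lemma wedge_pow_antisymmetric (w : ('I_2 -> V) -> R) r :
  antisymmetric_form (wedge_pow w r).
Proof.
case: r => [|r]; last exact: wedge_antisymmetric.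
by move=> s v /=; rewrite permS0 odd_perm1 expr0 mul1r.
Qed.

(** Grouping the permutations by their first value leaves, for each value, [l`!]
    equal terms, which cancel the normalisation of [wedge]. *)
Lemma wedge1E l (a : ('I_1 -> V) -> R) (b : ('I_l -> V) -> R) v :
  antisymmetric_form b ->
  wedge a b v = \sum_(j < l.+1) (-1) ^+ j *
    (a (fun _ => v j) * b (fun i => v (lift j i))).
Proof.
move=> anti_b; rewrite /wedge.
pose G (j : 'I_l.+1) (f : 'I_l -> 'I_l.+1) :=
  a (fun _ => v j) * b (fun i => v (f i)).
under eq_bigr => s _.
  have -> : a (fun i => v (s (lshift l i))) * b (fun j => v (s (rshift 1 j)))
    = G (s ord0) (fun i => s (lift ord0 i)).
    congr (a _ * b _); apply/funext => i; congr (v (s _)); apply/val_inj => //=.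
    by rewrite ord1.
  over.
rewrite (sum_perm_lift G) mulr_sumr; apply: eq_bigr => j _.
under eq_bigr => t _.
  rewrite /G (anti_b t (fun i => v (lift j i))) (mulrCA (a _)) signrMK; over.
by rewrite sumr_const card_Sn -[X in _ * X]mulr_natl (factS 0) mul1r mulKf.
Qed.

(** Same idea as for [wedge1E], applied to the first two values in turn; the
    factor [2^-1] is the [2`!] of the normalisation. *)
Lemma wedge2E l (a : ('I_2 -> V) -> R) (b : ('I_l -> V) -> R) v :
  antisymmetric_form b ->
  wedge a b v = 2^-1 * \sum_(j < l.+2) \sum_(k < l.+1) (-1) ^+ (j + k) *
    (a (vpair (v j) (v (lift j k))) * b (fun i => v (lift j (lift k i)))).
Proof.
move=> anti_b; rewrite /wedge.
pose G (j : 'I_l.+2) (f : 'I_l.+1 -> 'I_l.+2) :=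
  a (vpair (v j) (v (f ord0))) * b (fun i => v (f (lift ord0 i))).
under eq_bigr => s _.
  have -> : a (fun i => v (s (lshift l i))) * b (fun j => v (s (rshift 2 j)))
    = G (s ord0) (fun i => s (lift ord0 i)).
    congr (a _ * b _); apply/funext => i; last first.
      by congr (v (s _)); apply/val_inj.
    case: (unliftP ord0 i) => [i'|] ->; rewrite /vpair /=; congr (v (s _)).
      by apply/val_inj; rewrite /= ord1.
    exact/val_inj.
  over.
rewrite (sum_perm_lift G).
under eq_bigr => j _.
  rewrite -mulr_sumr.
  pose H (k : 'I_l.+1) (f : 'I_l -> 'I_l.+1) :=
    a (vpair (v j) (v (lift j k))) * b (fun i => v (lift j (f i))).
  rewrite (sum_perm_lift H).
  under eq_bigr => k _.
    under eq_bigr => t _.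
      rewrite /H (anti_b t (fun i => v (lift j (lift k i)))) (mulrCA (a _)).
      rewrite signrMK; over.
    rewrite sumr_const card_Sn -mulrnAr -[X in _ * X]mulr_natl mulrCA.
    over.
  rewrite -mulr_sumr mulrCA mulr_sumr.
  under eq_bigr => k _ do rewrite mulrA -exprD.
  over.
by rewrite -mulr_sumr invfM -mulrA mulKf.
Qed.

End Wedge.

(** * Wedge powers are alternating multilinear forms *)

Section Multilinear.
Local Set Implicit Arguments.
Local Unset Strict Implicit.
Context {R : realType} {V : lmodType R}.

Lemma subst_slot_comp k n (g : 'I_k -> 'I_n) (v : 'I_n -> V) p u :
  injective g ->
  (fun i => subst_slot v (g p) u (g i)) = subst_slot (fun i => v (g i)) p u.
Proof.
by move=> g_inj; apply/funext => i; rewrite /subst_slot (inj_eq g_inj).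
Qed.

Lemma subst_slot_out k n (g : 'I_k -> 'I_n) (v : 'I_n -> V) p u :
  (forall i, g i != p) ->
  (fun i => subst_slot v p u (g i)) = (fun i => v (g i)).
Proof.
by move=> gp; apply/funext => i; rewrite /subst_slot (negPf (gp i)).
Qed.

Lemma subst_slot_id k (v : 'I_k -> V) i : subst_slot v i (v i) = v.
Proof. by apply/funext => j; rewrite /subst_slot; case: eqP => // ->. Qed.

(** In each term of the sum over permutations, the slot [i] is read by exactly
    one of the two factors, and the other factor does not see it. *)
Lemma wedge_multilinear k l (a : ('I_k -> V) -> R) (b : ('I_l -> V) -> R) :
  is_multilinear a -> is_multilinear b -> is_multilinear (wedge a b).
Proof.
move=> lin_a lin_b v i t u w; rewrite /wedge mulrCA -mulrDr; congr (_ * _).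
rewrite mulr_sumr -big_split /=; apply: eq_bigr => s _.
have injl : injective (fun i => s (lshift l i)).
  by move=> x y /perm_inj /lshift_inj.
have injr : injective (fun i => s (rshift k i)).
  by move=> x y /perm_inj /rshift_inj.
(* [p] is the position at which the permuted arguments show the slot [i]. *)
rewrite -(permKV s i); case: (split_ordP ((s^-1)%g i)) => p ->.
  have out j : s (rshift k j) != s (lshift l p).
    by rewrite (inj_eq perm_inj) eq_rlshift.
  rewrite !(subst_slot_comp _ _ _ injl) !(subst_slot_out _ _ out) lin_a.
  by rewrite mulrDl mulrDr -mulrA mulrCA.
have out j : s (lshift l j) != s (rshift k p).
  by rewrite (inj_eq perm_inj) eq_lrshift.
rewrite !(subst_slot_comp _ _ _ injr) !(subst_slot_out _ _ out) lin_b.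
by rewrite !mulrDr (mulrCA t) (mulrCA t).
Qed.

Lemma wedge_pow_multilinear (w : ('I_2 -> V) -> R) r :
  is_multilinear w -> is_multilinear (wedge_pow w r).
Proof.
by move=> lin_w; elim: r => [v []//|r IH]; exact: wedge_multilinear.
Qed.

Lemma multilinear_sum k (a : ('I_k -> V) -> R) v i (m : nat)
    (c : 'I_m -> R) (x : 'I_m -> V) :
  is_multilinear a ->
  a (subst_slot v i (\sum_j c j *: x j)) =
  \sum_j c j * a (subst_slot v i (x j)).
Proof.
move=> lin_a; elim/big_rec2: _ => [|j y z _ <-]; last exact: lin_a.
have := lin_a v i (-1) 0 0; rewrite scaler0 addr0 mulN1r => ->.
by rewrite addNr.
Qed.

Lemma antisymmetric_alternating k (a : ('I_k -> V) -> R) :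
  antisymmetric_form a -> is_alternating a.
Proof.
move=> anti_a v i j ij vij.
have := anti_a (tperm i j) v; rewrite odd_tperm ij expr1 mulN1r.
rewrite (_ : (fun _ => _) = v); first by move=> E; lra.
by apply/funext => x; case: tpermP => // ->.
Qed.

End Multilinear.

(** * Powers of a two-form evaluated on orthogonal vectors *)

Section TwoForm.
Local Set Implicit Arguments.
Local Unset Strict Implicit.
Context {R : realType} {V : lmodType R}.
Variable w : ('I_2 -> V) -> R.
Hypotheses (lin_w : is_multilinear w) (alt_w : is_alternating w).

Lemma vcons0 k (u : V) (v : 'I_k -> V) : vcons u v ord0 = u.
Proof. by rewrite /vcons unlift_none. Qed.

Lemma vconsS k (u : V) (v : 'I_k -> V) i : vcons u v (lift ord0 i) = v i.
Proof. by rewrite /vcons liftK. Qed.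

Lemma vpair_linearl t (u1 u2 u : V) :
  w (vpair (t *: u1 + u2) u) = t * w (vpair u1 u) + w (vpair u2 u).
Proof.
have E x : vpair x u = subst_slot (vpair 0 u) ord0 x.
  by apply/funext => i; rewrite /vpair /subst_slot; case: eqP.
by rewrite (E (_ + _)) (E u1) (E u2) lin_w.
Qed.

Lemma vpair_diag (u : V) : w (vpair u u) = 0.
Proof. by apply: (alt_w (i := ord0) (j := lift ord0 ord0)). Qed.

Lemma vpair_skew (u x : V) : w (vpair u x) = - w (vpair x u).
Proof.
have E y z : vpair y z = subst_slot (vpair y 0) (lift ord0 ord0) z.
  apply/funext => i; rewrite /vpair /subst_slot.
  by case: (unliftP ord0 i) => [j ->|->] //=; rewrite ord1.
have D y z z' : w (vpair y (z + z')) = w (vpair y z) + w (vpair y z').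
  by rewrite -[z]scale1r E lin_w mul1r -!E scale1r.
have := vpair_diag (1 *: u + x).
by rewrite vpair_linearl !D scale1r !vpair_diag => H; lra.
Qed.

(** Every term of the full expansion pairs [v i] with some entry under [w]. *)
Lemma wedge_pow_orth r (v : 'I_(r * 2) -> V) i :
  (forall j, w (vpair (v i) (v j)) = 0) -> wedge_pow w r v = 0.
Proof.
elim: r v i => [v []//|r IH] v i orth /=.
rewrite wedge2E; last exact: wedge_pow_antisymmetric.
apply/eqP; rewrite mulf_eq0; apply/orP; right; apply/eqP.
apply: big1 => j _; apply: big1 => k _.
case: (unliftP j i) => [i1|] Ei; last first.
  by rewrite -Ei orth mul0r mulr0.
case: (unliftP k i1) => [i2|] Ei1; last first.
  by rewrite vpair_skew -Ei1 -Ei orth oppr0 mul0r mulr0.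
rewrite (IH _ i2) ?mulr0 // => j'.
by rewrite -Ei1 -Ei.
Qed.

(** Only the term in which [a] takes [u] survives: in the others [u] is an
    argument of the power of [w], orthogonal to all the other ones. *)
Lemma wedge1_orth r (a : ('I_1 -> V) -> R) u (v : 'I_(r * 2) -> V) :
  (forall j, w (vpair u (v j)) = 0) ->
  wedge a (wedge_pow w r) (vcons u v) = a (fun _ => u) * wedge_pow w r v.
Proof.
move=> orth; rewrite wedge1E; last exact: wedge_pow_antisymmetric.
rewrite big_ord_recl /= mul1r vcons0 big1 ?addr0 => [|j _].
  by congr (_ * wedge_pow w r _); apply/funext => i; rewrite vconsS.
case: (unliftP (lift ord0 j) ord0) => [i Ei|/eqP].
  rewrite (wedge_pow_orth (i := i)) ?mulr0 // -Ei vcons0 => i'.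
  case: (unliftP ord0 (lift (lift ord0 j) i')) => [j'|] ->.
    by rewrite vconsS.
  by rewrite vcons0 vpair_diag.
by [].
Qed.

Lemma lift_lift0 n (j : 'I_n.+1) (k : 'I_n) :
  lift (lift ord0 j) (lift ord0 k) = lift ord0 (lift j k).
Proof. by apply/val_inj; rewrite /= /bump; lia. Qed.

Lemma lift_lift00 n (j : 'I_n.+1) : lift (lift ord0 j) ord0 = ord0.
Proof. exact/val_inj. Qed.

Lemma sum_ord_recl2 n (F : 'I_n.+2 -> R) :
  \sum_i F i =
  F ord0 + F (lift ord0 ord0) + \sum_i F (lift ord0 (lift ord0 i)).
Proof. by rewrite !big_ord_recl addrA. Qed.

(** In the double expansion of the left-hand side, [w] sees [e] and [f] together
    in two equal terms, which contribute [w (e, f) (w /\ b) (v)]. By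
    orthogonality it otherwise sees two entries of [v]; the remaining factor
    then has the shape of the hypothesis, and these terms add up to the
    expansion of [w /\ b] at [v], scaled by [c * w (e, f)]. *)
Lemma wedge_pair_step l c (b : ('I_l -> V) -> R) e f (v : 'I_l.+2 -> V) :
  antisymmetric_form b ->
  (forall y : 'I_l -> V,
    (forall j, w (vpair e (y j)) = 0) -> (forall j, w (vpair f (y j)) = 0) ->
    wedge w b (vcons e (vcons f y)) = c * (w (vpair e f) * b y)) ->
  (forall j, w (vpair e (v j)) = 0) -> (forall j, w (vpair f (v j)) = 0) ->
  wedge w (wedge w b) (vcons e (vcons f v)) =
  (1 + c) * (w (vpair e f) * wedge w b v).
Proof.
move=> anti_b IH orth_e orth_f.
have orth_e' j : w (vpair (v j) e) = 0 by rewrite vpair_skew orth_e oppr0.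
have orth_f' j : w (vpair (v j) f) = 0 by rewrite vpair_skew orth_f oppr0.
rewrite wedge2E; last exact: wedge_antisymmetric.
set x := vcons e (vcons f v).
have x0 : x ord0 = e by rewrite /x vcons0.
have x1 : x (lift ord0 ord0) = f by rewrite /x vconsS vcons0.
have x2 j : x (lift ord0 (lift ord0 j)) = v j by rewrite /x !vconsS.
rewrite sum_ord_recl2.
(* [e] comes first. *)
have -> : \sum_(k < l.+3) (-1) ^+ (@ord0 l.+3 + k) *
    (w (vpair (x ord0) (x (lift ord0 k))) *
     wedge w b (fun i => x (lift ord0 (lift k i)))) =
    w (vpair e f) * wedge w b v.
  rewrite big_ord_recl big1 ?addr0 => [|k _].
    rewrite expr0 mul1r x0 x1; congr (_ * wedge w b _).
    by apply/funext => i; rewrite x2.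
  by rewrite x0 x2 orth_e mul0r mulr0.
(* [f] comes first; the two signs cancel. *)
have -> : \sum_(k < l.+3) (-1) ^+ (lift ord0 (@ord0 l.+2) + k) *
    (w (vpair (x (lift ord0 ord0)) (x (lift (lift ord0 ord0) k))) *
     wedge w b (fun i => x (lift (lift ord0 ord0) (lift k i)))) =
    w (vpair e f) * wedge w b v.
  rewrite big_ord_recl big1 ?addr0 => [|k _].
    rewrite /= addn0 expr1 lift_lift00 x0 x1 (vpair_skew f e).
    rewrite mulN1r mulNr opprK.
    congr (_ * wedge w b _).
    by apply/funext => i; rewrite lift_lift0 x2.
  by rewrite lift_lift0 x1 x2 orth_f mul0r mulr0.
(* An entry of [v] comes first; the factor 2 undoes that of [wedge2E]. *)
have -> : \sum_(j < l.+2) \sum_(k < l.+3)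
    (-1) ^+ (lift ord0 (lift ord0 j) + k) *
    (w (vpair (x (lift ord0 (lift ord0 j)))
              (x (lift (lift ord0 (lift ord0 j)) k))) *
     wedge w b (fun i => x (lift (lift ord0 (lift ord0 j)) (lift k i)))) =
    c * w (vpair e f) * (2 * wedge w b v).
  rewrite [in RHS]wedge2E // mulVKf ?pnatr_eq0 //.
  rewrite mulr_sumr; apply: eq_bigr => j _.
  rewrite sum_ord_recl2 !lift_lift00 !lift_lift0 lift_lift00 x0 x1 x2.
  rewrite orth_e' orth_f' !mul0r !mulr0 !add0r mulr_sumr.
  apply: eq_bigr => k _; rewrite !lift_lift0 x2.
  have -> : (fun i => x (lift (lift ord0 (lift ord0 j))
                           (lift (lift ord0 (lift ord0 k)) i))) =
      vcons e (vcons f (fun i => v (lift j (lift k i)))).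
    apply/funext => i.
    case: (unliftP ord0 i) => [i1|] ->; last by rewrite !lift_lift00 vcons0.
    rewrite !lift_lift0 vconsS.
    case: (unliftP ord0 i1) => [i2|] ->; last by rewrite !lift_lift00 vcons0.
    by rewrite !lift_lift0 x2 vconsS.
  rewrite IH // !lift0 !addSn !addnS !exprS !mulN1r !opprK.
  set p := (-1) ^+ _; set q := w _; set q' := w _; set z := b _.
  by move: p q q' z => p q q' z; ring.
set q := w _; set z := wedge w b v.
by move: q z => q z; field.
Qed.

(** Each of the [r + 1] factors of the power can be the one that sees [e] and [f]
    together, and by symmetry they contribute equally. *)
Lemma wedge_pow_pair r e f (v : 'I_(r * 2) -> V) :
  (forall j, w (vpair e (v j)) = 0) -> (forall j, w (vpair f (v j)) = 0) ->
  wedge_pow w r.+1 (vcons e (vcons f v)) =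
  r.+1%:R * (w (vpair e f) * wedge_pow w r v).
Proof.
elim: r v => [|r IH] v orth_e orth_f.
  rewrite /= wedge2E; last by move=> s x; rewrite permS0 odd_perm1 mul1r.
  rewrite !big_ord_recl !big_ord0 /= lift_lift00 !vconsS !vcons0.
  by rewrite (vpair_skew f e) /bump /= expr1 expr0; field.
rewrite -[r.+2%:R]/(1 + r.+1)%:R natrD.
by apply: wedge_pair_step => //; exact: wedge_pow_antisymmetric.
Qed.

End TwoForm.

(** * Dimension and the vanishing of powers *)

Section LinearAlgebra.
Local Set Implicit Arguments.
Local Unset Strict Implicit.
Context {R : realType} {V : vectType R}.

(** The components of the [v i] in a complement of [N] are too many to be
    independent there. *)
Lemma dependent_mod (N : {vspace V}) m (v : 'I_m -> V) :
  (\dim {:V} < m + \dim N)%N ->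
  exists c : 'I_m -> R,
    \sum_i c i *: v i \in N /\ exists i, c i != 0.
Proof.
move=> ltD; pose y := [tuple v i - projv N (v i) | i < m].
have /freeP : ~~ free y.
  apply/negP => /eqP free_y.
  have : (<<y>> <= N^C)%VS.
    by apply/span_subvP => _ /mapP[i _ ->]; exact: memv_projC.
  move=> /dimvS; rewrite free_y dimv_compl size_tuple => le_m.
  by have := dimvS (subvf N); lia.
move=> /existsNP[c] /not_implyP[c0 /existsNP[i /eqP ci]].
exists c; split; last by exists i.
move: c0; under eq_bigr => j _ do rewrite -tnth_nth tnth_mktuple scalerBr.
rewrite sumrB => /subr0_eq ->; apply: memv_suml => j _.
by rewrite memvZ // memv_proj.
Qed.

(** Replace an entry [v i] that has a nonzero coefficient in a combination lying
    in [N] by this combination: the form vanishes there, and by alternation only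
    the multiple of [a v] survives in its expansion. *)
Lemma form_eq0 (N : {vspace V}) m (a : ('I_m -> V) -> R) :
  is_multilinear a -> is_alternating a ->
  (forall v i, v i \in N -> a v = 0) ->
  (\dim {:V} < m + \dim N)%N -> forall v, a v = 0.
Proof.
move=> lin_a alt_a aN ltD v.
have [c [cN [i ci]]] := dependent_mod v ltD.
have := multilinear_sum v i c v lin_a.
rewrite (aN _ i); last by rewrite /subst_slot eqxx.
rewrite (bigD1 i) //= subst_slot_id big1 ?addr0 => [/esym/eqP|j ji].
  by rewrite mulf_eq0 (negPf ci) => /eqP.
rewrite (alt_a _ i j) ?mulr0 1?eq_sym //.
by rewrite /subst_slot eqxx (negPf ji).
Qed.

Variable w : ('I_2 -> V) -> R.
Hypotheses (lin_w : is_multilinear w) (alt_w : is_alternating w).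

(** [U'] is the [w]-orthogonal of [e] and [f] in [U]. Since they span a plane
    on which [w] is nondegenerate, [U] is the sum of the plane and [U']; this
    gives the dimension bound, and puts the radical of [U'] in that of [U]. *)
Lemma hyperbolic_complement (U : {vspace V}) e f :
  e \in U -> f \in U -> w (vpair e f) != 0 ->
  exists U' : {vspace V},
    [/\ (U' <= U)%VS, (\dim U <= \dim U' + 2)%N,
        forall u, u \in U' -> w (vpair e u) = 0 /\ w (vpair f u) = 0 &
        forall u, (forall z, z \in U' -> w (vpair u z) = 0) -> u \in U' ->
          forall z, z \in U -> w (vpair u z) = 0].
Proof.
move=> Ue Uf ef.
have skew := vpair_skew lin_w alt_w.
have linl := vpair_linearl lin_w.
have linr t z1 z2 u :
    w (vpair u (t *: z1 + z2)) = t * w (vpair u z1) + w (vpair u z2).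
  by rewrite skew linl (skew u z1) (skew u z2) mulrN -opprD.
pose P u := [/\ u \in U, w (vpair u e) = 0 & w (vpair u f) = 0].
have w0 u : w (vpair 0 u) = 0.
  by have := linl (-1) 0 0 u; rewrite scaler0 addr0 mulN1r addNr.
have [|t u z [uU ue uf] [zU ze zf]|U' PU'] := @linear_set_vspace R V P.
- by split; rewrite ?mem0v ?w0.
- by split; rewrite ?linl ?ue ?ze ?uf ?zf ?mulr0 ?addr0 // memvD // memvZ.
have U'P u : (u \in U') = P u :> Prop.
  by have := congr1 (fun A : set V => A u) PU'.
(* Projection onto the plane spanned by [e] and [f] along its orthogonal. *)
have dec z : z \in U -> exists s t u, u \in U' /\ z = s *: e + (t *: f + u).
  move=> zU; pose d := w (vpair e f).
  pose s := w (vpair z f) / d; pose t := - (w (vpair z e) / d).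
  exists s, t, (- s *: e + (- t *: f + z)).
  split; last by clearbody s t; rewrite !scaleNr (addrCA (t *: f)) !addNKr.
  rewrite U'P; split.
  - by rewrite !memvD // memvZ.
  - rewrite !linl vpair_diag // (skew f e) -/d mulr0 add0r /t.
    by rewrite opprK mulrN divfK // addNr.
  - rewrite !linl vpair_diag // -/d mulr0 add0r /s.
    by rewrite mulNr divfK // addNr.
exists U'; split.
- by apply/subvP => u; rewrite U'P => -[].
- have : (U <= <[e]> + (<[f]> + U'))%VS.
    apply/subvP => z /dec[s [t [u [uU' ->]]]].
    by rewrite !memv_add // memvZ // memv_line.
  move=> /dimvS; have [+ _] := dimv_add_leqif <[e]> (<[f]> + U').
  have [+ _] := dimv_add_leqif <[f]> U'; rewrite !dim_vline.
  by case: (e != 0); case: (f != 0) => /=; lia.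
- by move=> u; rewrite U'P => -[_ ue uf]; rewrite !(skew _ u) ue uf oppr0.
- move=> u orth; rewrite U'P => -[_ ue uf] z /dec[s [t [z' [zU' ->]]]].
  by rewrite !linr ue uf orth // !mulr0 !addr0.
Qed.

(** The hypothesis bounds the radical of [w] on [U] through all subspaces
    [W <= U] orthogonal to [U], of which the radical is the largest; in this
    form it passes to the orthogonal of a hyperbolic pair by inclusion alone.
    The bound is one weaker than [\dim W + 2 * r <= \dim U], which is harmless
    since the corank of the radical is even, and is what is available when
    [tau] does not vanish on the radical. *)
Lemma wedge_pow_neq0 r (U : {vspace V}) :
  (forall W : {vspace V}, (W <= U)%VS ->
     (forall u z, u \in W -> z \in U -> w (vpair u z) = 0) ->
     (\dim W + 2 * r <= (\dim U).+1)%N) ->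
  exists v : 'I_(r * 2) -> V, (forall i, v i \in U) /\ wedge_pow w r v != 0.
Proof.
elim: r U => [|r IH] U rkU.
  by exists (fun _ => 0); split=> [[]//|]; exact: oner_neq0.
have [[e [f [Ue Uf ef]]]|isoU] :=
    pselect (exists e f, [/\ e \in U, f \in U & w (vpair e f) != 0]);
    last first.
  have := rkU U (subvv U).
  suff iso u z : u \in U -> z \in U -> w (vpair u z) = 0.
    by move=> /(_ iso); lia.
  move=> uU zU; apply/eqP; apply: contrapT => /negP uz.
  by apply: isoU; exists u, z.
have [U' [U'U dimU' orth radU']] := hyperbolic_complement Ue Uf ef.
have [|v [vU' v0]] := IH U'.
  move=> W WU' isoW; suff : (\dim W + 2 * r.+1 <= (\dim U).+1)%N by lia.
  apply: rkU; first exact: subv_trans U'U.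
  move=> u z uW zU; apply: radU' zU; last exact: (subvP WU').
  by move=> z' zU'; exact: isoW.
exists (vcons e (vcons f v)); split.
  move=> i; case: (unliftP ord0 i) => [i1|] ->; last by rewrite vcons0.
  rewrite vconsS; case: (unliftP ord0 i1) => [i2|] ->; last by rewrite vcons0.
  by rewrite vconsS (subvP U'U).
rewrite wedge_pow_pair //; last 2 first.
- by move=> j; have [] := orth _ (vU' j).
- by move=> j; have [] := orth _ (vU' j).
by rewrite !mulf_neq0 // pnatr_eq0.
Qed.

End LinearAlgebra.

(** * The class at a point *)

Section Pointwise.
Local Set Implicit Arguments.
Local Unset Strict Implicit.
Context {R : realType} {V : vectType R}.
Variables (tau : ('I_1 -> V) -> R) (w : ('I_2 -> V) -> R).
Hypotheses (lin_tau : is_multilinear tau).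
Hypotheses (lin_w : is_multilinear w) (alt_w : is_alternating w).

Lemma Ker1E u : Ker tau u <-> tau (fun _ => u) = 0.
Proof.
have E v : vcons u v = (fun _ : 'I_1 => u).
  by apply/funext => i; rewrite ord1 vcons0.
split=> [/(congr1 (@^~ (fun _ => 0)))|tu].
  by rewrite /= /Defs.contraction E.
by apply/funext => v; rewrite /Defs.contraction E.
Qed.

Lemma Ker2E u : Ker w u <-> forall z, w (vpair u z) = 0.
Proof.
have E v : vcons u v = vpair u (v ord0).
  apply/funext => i; case: (unliftP ord0 i) => [j|] ->; last by rewrite vcons0.
  by rewrite vconsS ord1.
split=> [wu z|wu]; last by apply/funext => v; rewrite /Defs.contraction E.
by have := congr1 (@^~ (fun _ => z)) wu; rewrite /= /Defs.contraction E.
Qed.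

Lemma form_neq0P k (a : ('I_k -> V) -> R) : a <> 0 <-> exists v, a v != 0.
Proof.
split=> [a0|[v /eqP av] a0]; last by apply: av; rewrite a0.
apply: contrapT => /forallNP av; apply: a0; apply/funext => v.
by apply/eqP; apply: contrapT => /negP; exact: av.
Qed.

Variables (N K : {vspace V}).
Hypotheses (NE : [set` N]%classic = Ker w)
  (KE : [set` K]%classic = (Ker tau `&` Ker w)%classic).

Lemma memNP u : u \in N <-> forall z, w (vpair u z) = 0.
Proof.
rewrite -Ker2E -NE; exact: iff_refl.
Qed.

Lemma memKP u : u \in K <-> tau (fun _ => u) = 0 /\ u \in N.
Proof.
have -> : (u \in K : Prop) = [set` K]%classic u by [].
rewrite KE -Ker1E; split=> -[tu]; rewrite -NE; by [].
Qed.

Lemma wedge_pow_eq0 r : (\dim {:V} < 2 * r + \dim N)%N -> wedge_pow w r = 0.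
Proof.
move=> ltD; apply/funext; apply: form_eq0 (_ : (_ < r * 2 + \dim N)%N).
- exact: wedge_pow_multilinear.
- exact/antisymmetric_alternating/wedge_pow_antisymmetric.
- move=> v i /memNP vN; exact: (wedge_pow_orth lin_w alt_w (i := i)).
- by rewrite mulnC.
Qed.

Lemma wedge1_pow_eq0 r :
  (\dim {:V} < (2 * r).+1 + \dim K)%N -> wedge tau (wedge_pow w r) = 0.
Proof.
move=> ltD; apply/funext; apply: form_eq0 (_ : (_ < 1 + r * 2 + \dim K)%N).
- by apply: wedge_multilinear => //; exact: wedge_pow_multilinear.
- exact/antisymmetric_alternating/wedge_antisymmetric.
- move=> v i /memKP[tau0 /memNP vN]; rewrite wedge1E; last first.
    exact: wedge_pow_antisymmetric.
  apply: big1 => j _; case: (unliftP j i) => [i'|] Ei.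
    by rewrite (wedge_pow_orth lin_w alt_w (i := i')) ?mulr0 // -Ei.
  by rewrite -Ei tau0 mul0r mulr0.
- by rewrite add1n mulnC.
Qed.

Lemma wedge_pow_neq0_dim r :
  (\dim N + 2 * r <= (\dim {:V}).+1)%N -> wedge_pow w r <> 0.
Proof.
move=> leD.
have [|v [_ v0]] := wedge_pow_neq0 lin_w alt_w (U := fullv) (r := r).
  move=> W _ isoW; apply: leq_trans leD; rewrite leq_add2r; apply: dimvS.
  by apply/subvP => u uW; apply/memNP => z; apply: isoW; rewrite ?memvf.
by apply/form_neq0P; exists v.
Qed.

Lemma wedge1_pow_neq0 r u :
  u \in N -> tau (fun _ => u) != 0 -> wedge_pow w r <> 0 ->
  wedge tau (wedge_pow w r) <> 0.
Proof.
move=> /memNP uN tu /form_neq0P[v v0]; apply/form_neq0P; exists (vcons u v).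
by rewrite wedge1_orth // mulf_neq0.
Qed.

Lemma dimK_le : (\dim K <= \dim N)%N.
Proof. by apply/dimvS/subvP => u /memKP[]. Qed.

(** [K] is the kernel in [N] of the single linear form [tau]. *)
Lemma dimN_le : (\dim N <= (\dim K).+1)%N.
Proof.
have linT t u1 u2 : tau (fun _ => t *: u1 + u2) =
    t * tau (fun _ => u1) + tau (fun _ => u2).
  have E (x : V) : (fun _ => x) = subst_slot (fun _ : 'I_1 => 0) ord0 x.
    by apply/funext => i; rewrite /subst_slot ord1 eqxx.
  by rewrite (E (_ + _)) (E u1) (E u2) lin_tau.
have [[n [nN tn]]|tauN] := pselect (exists n, n \in N /\ tau (fun _ => n) != 0).
  have : (N <= <[n]> + K)%VS.
    apply/subvP => u uN; pose t := tau (fun _ => u) / tau (fun _ => n).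
    rewrite -[u](addKr (- t *: n)) -scaleNr opprK memv_add ?memvZ ?memv_line //.
    by apply/memKP; rewrite linT mulNr divfK // addNr memvD // memvZ.
  move=> /dimvS; have [+ _] := dimv_add_leqif <[n]> K.
  by rewrite dim_vline; case: (n != 0) => /=; lia.
apply/leqW/dimvS/subvP => u uN; apply/memKP; split => //.
by apply/eqP; apply: contrapT => /negP tu; apply: tauN; exists u.
Qed.

(** [wedge_pow_eq0] and [wedge_pow_neq0_dim] turn the vanishing of powers of [w]
    into bounds on [\dim N]; the condition on [tau] makes [N] equal to [K]. *)
Lemma pointwise_class r :
  (\dim {:V} - \dim K)%N = (2 * r)%N <->
  [/\ wedge_pow w r <> 0, wedge_pow w r.+1 = 0 &
      wedge tau (wedge_pow w r) = 0].
Proof.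
have leK := dimvS (subvf K); have leN := dimvS (subvf N).
have leNK := dimN_le; have leKN := dimK_le.
split=> [dimK|[wr wr1 tauwr]].
  split; first by apply: wedge_pow_neq0_dim; lia.
    by apply: wedge_pow_eq0; lia.
  by apply: wedge1_pow_eq0; lia.
have ltN : ~ (\dim {:V} < 2 * r + \dim N)%N by move=> /wedge_pow_eq0.
have gtN : ~ (\dim N + 2 * r.+1 <= (\dim {:V}).+1)%N.
  by move=> /wedge_pow_neq0_dim.
suff : (\dim N <= \dim K)%N by lia.
apply/dimvS/subvP => u uN; apply/memKP; split => //.
apply/eqP; apply: contrapT => /negP tu.
exact: wedge1_pow_neq0 uN tu wr tauwr.
Qed.

(** If [w^(r+1)] were not zero, a vector on which [tau] is not zero would belong
    to a hyperbolic pair orthogonal to [r] further ones, or else to [N]; in both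
    cases it is orthogonal to arguments on which [w^r] is not zero. *)
Lemma wedge_powS_eq0 r :
  tau <> 0 -> wedge_pow w r <> 0 -> wedge tau (wedge_pow w r) = 0 ->
  wedge_pow w r.+1 = 0.
Proof.
move=> /form_neq0P[u' tu'] wr tauwr.
pose u := u' ord0.
have tu : tau (fun _ => u) != 0.
  by rewrite (_ : (fun _ => u) = u') //; apply/funext => i; rewrite ord1.
apply: contrapT => wr1.
have ltN : ~ (\dim {:V} < 2 * r.+1 + \dim N)%N by move=> /wedge_pow_eq0.
have [uN|/negP uN] := boolP (u \in N).
  exact: wedge1_pow_neq0 uN tu wr tauwr.
have [f /eqP uf] : exists f, w (vpair u f) <> 0.
  by apply/existsNP => /memNP.
have [U [_ dimU orth radU]] :=
  hyperbolic_complement lin_w alt_w (memvf u) (memvf f) uf.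
have [|v [vU v0]] := wedge_pow_neq0 lin_w alt_w (U := U) (r := r).
  move=> W WU isoW; suff : (\dim W <= \dim N)%N by lia.
  apply/dimvS/subvP => z zW; apply/memNP => z'.
  apply: radU (subvP WU z zW) _ (memvf z').
  by move=> y yU; exact: isoW.
move: tauwr; apply/form_neq0P; exists (vcons u v).
rewrite wedge1_orth //; first by rewrite mulf_neq0.
by move=> j; have [] := orth _ (vU j).
Qed.

End Pointwise.

(** * The theorem on a manifold *)

Section Manifold.
Context {R : realType} {n : nat} {M : manifold R n}.
Variables (tau : diff_form M 1) (omega : diff_form M 2).

Lemma pair_classE r x :
  (pair_class tau omega x = (2 * r)%N <->
   [/\ wedge_pow (omega x) r <> 0, wedge_pow (omega x) r.+1 = 0 &
       wedge (tau x) (wedge_pow (omega x) r) = 0]) /\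
  (tau x <> 0 -> wedge_pow (omega x) r <> 0 ->
   wedge (tau x) (wedge_pow (omega x) r) = 0 ->
   wedge_pow (omega x) r.+1 = 0).
Proof.
have [w0 wl] := Ker_linear (form_multilinear omega x).
have [N NE] := linear_set_vspace w0 wl.
have [K KE] := pair_kernel_vspace tau omega x.
have lt := form_multilinear tau x.
have lw := form_multilinear omega x; have aw := form_alternating omega x.
split; last exact: (wedge_powS_eq0 lw aw NE).
by rewrite /pair_class -KE codimE; exact: (pointwise_class lt lw aw NE KE).
Qed.

End Manifold.

Theorem proposition2p20 (R : realType) (n : nat) (M : manifold R n)
    (tau : diff_form M 1) (omega : diff_form M 2) (r : nat) :
  (doublet_of_class tau omega (2 * r)%N <->
     forall x : M,
       [/\ wedge_pow (omega x) r <> 0,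
           wedge_pow (omega x) r.+1 = 0 &
           wedge (tau x) (wedge_pow (omega x) r) = 0]) /\
  ((forall x : M, tau x <> 0) ->
     (doublet_of_class tau omega (2 * r)%N <->
        forall x : M,
          wedge_pow (omega x) r <> 0 /\
          wedge (tau x) (wedge_pow (omega x) r) = 0)).
Proof.
have classE : doublet_of_class tau omega (2 * r)%N <->
    forall x, pair_class tau omega x = (2 * r)%N.
  by split=> [[]//|cl]; split=> //; exists (2 * r)%N.
have first_claim : doublet_of_class tau omega (2 * r)%N <->
     forall x : M,
       [/\ wedge_pow (omega x) r <> 0,
           wedge_pow (omega x) r.+1 = 0 &
           wedge (tau x) (wedge_pow (omega x) r) = 0].
  by rewrite classE; split=> H x; apply/(pair_classE tau omega r x).1.
split=> // tau0; rewrite first_claim; split=> H x; have := H x.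
  by case.
by case=> wr tauwr; split=> //; apply: (pair_classE tau omega r x).2.
Qed.
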